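(* Let $G$ be a group acting on a $\delta$-hyperbolic geodesic metric space $(X,d_X)$ by isometries and let $\phi_1,\phi_2\in G$. Suppose $C>100\delta$ and the almost fixed sets $\mathcal{X}_C(\phi_1)$ and $\mathcal{X}_C(\phi_2)$ of $\langle\phi_1\rangle$ and $\langle\phi_2\rangle$, respectively, have diameters bounded above by a constant $C'$. Then there exists a constant $C_1$ such that, whenever $d_X(\mathcal{X}_C(\phi_1),\mathcal{X}_C(\phi_2))\ge C_1$, (1) $\langle\phi_1,\phi_2\rangle\simeq F_2$ (the free group of rank $2$); and (2) every element of $\langle\phi_1,\phi_2\rangle$ which is not conjugate in $\langle\phi_1,\phi_2\rangle$ to a power of $\phi_1$ or of $\phi_2$ acts loxodromically on $X$.
   Context: For $g\in G$ let $X_C(g)=\{x\in X:\exists\, n\ne 0 \text{ such that } d_X(x,g^n x)\le C\}$. The almost fixed set $\mathcal{X}_C(g)$ of $\langle g\rangle$ is taken to be the quasi-convex hull of $X_C(g)$, i.e. the union of all geodesics of $X$ connecting two points of $X_C(g)$. The distance between two subsets is the infimum of the distances between their points. $\delta$-hyperbolicity of a geodesic metric space: for $x,y,z\in X$ put $(y,z)_x=\frac12(d_X(y,x)+d_X(z,x)-d_X(y,z))$; the initial segments of length $(y,z)_x$ of any two geodesics $[x,y]$ and $[x,z]$ are contained in the $2\delta$-neighborhoods of each other. An isometry $g$ of $X$ acts loxodromically if for some (equivalently, any) $x\in X$ the map $n\mapsto g^n x$ is a quasi-isometric embedding $\mathbb{Z}\to X$.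
   Formalization: The almost fixed sets of both elements are assumed nonempty (otherwise their distance is an infimum over the empty set, and equal long translations of the line give a counterexample); the constant C_1 is chosen depending only on δ, C and C'. *)

(* Defs.v *)
From HB Require Import structures.
From mathcomp Require Import all_boot all_order all_algebra.
From mathcomp Require Import all_classical all_reals all_analysis.

Set Implicit Arguments.
Unset Strict Implicit.
Unset Printing Implicit Defensive.

Import Order.TTheory GRing.Theory Num.Theory.

Local Open Scope classical_set_scope.
Local Open Scope ring_scope.

(* The free group on T, as reduced words in the letters (t, true) = t and
   (t, false) = t^-1; [fg_push] multiplies a reduced word by a letter on the
   left. *)
Section FreeGroup.
Variable T : choiceType.
Local Notation letter := (T * bool)%type.
Implicit Types (a b : letter) (u v w : seq letter).

Definition fg_linv a : letter := (a.1, ~~ a.2).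

Definition fg_reduced w : bool := sorted (fun a b => b != fg_linv a) w.

Definition fg_push a w : seq letter :=
  if w is b :: w' then if b == fg_linv a then w' else a :: w else [:: a].

Definition fg_cat u v : seq letter := foldr fg_push v u.

Definition fg_rev u : seq letter := rev (map fg_linv u).

Lemma fg_linvK : involutive fg_linv.
Proof. by case=> t b; rewrite /fg_linv /= negbK. Qed.

Lemma fg_reduced_push a w : fg_reduced w -> fg_reduced (fg_push a w).
Proof.
case: w => [|b w] //=; case: ifP => [_ /path_sorted //|].
by move=> neq Hw /=; rewrite neq.
Qed.

Lemma fg_pushK a w : fg_reduced w -> fg_push (fg_linv a) (fg_push a w) = w.
Proof.
case: w => [|b w] /=; first by rewrite fg_linvK eqxx.
case: (eqVneq b (fg_linv a)) => [->|_ _] /=; last by rewrite fg_linvK eqxx.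
by case: w => [|c w] //= /andP[/negbTE ->].
Qed.

Lemma fg_reduced_cat u v : fg_reduced v -> fg_reduced (fg_cat u v).
Proof. by move=> Hv; elim: u => //= a u; exact: fg_reduced_push. Qed.

Lemma fg_cat_push a v w : fg_reduced w ->
  fg_cat (fg_push a v) w = fg_push a (fg_cat v w).
Proof.
move=> Hw; case: v => [|b v] //=; case: eqP => [->|_] //=.
have := fg_pushK (fg_linv a) (fg_reduced_cat v Hw).
by rewrite fg_linvK.
Qed.

Lemma fg_catA u v w : fg_reduced w ->
  fg_cat u (fg_cat v w) = fg_cat (fg_cat u v) w.
Proof. by move=> Hw; elim: u => //= a u ->; rewrite fg_cat_push. Qed.

Lemma fg_catw0 u : fg_reduced u -> fg_cat u [::] = u.
Proof.
elim: u => //= a u IHu Hu; rewrite IHu; last exact: path_sorted Hu.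
by case: u Hu {IHu} => //= b u /andP[/negbTE ->].
Qed.

Lemma fg_reduced_rev u : fg_reduced u -> fg_reduced (fg_rev u).
Proof.
rewrite /fg_reduced /fg_rev rev_sorted sorted_map.
congr is_true; case: u => //= a u; apply: eq_path => b c /=.
by rewrite /relpre /= fg_linvK eq_sym (can2_eq fg_linvK fg_linvK).
Qed.

Lemma fg_catVw u : fg_cat (fg_rev u) u = [::].
Proof.
rewrite /fg_rev; elim: u => //= a u IHu.
by rewrite rev_cons /fg_cat foldr_rcons /= fg_linvK eqxx.
Qed.

Lemma fg_revK : involutive fg_rev.
Proof.
move=> u; rewrite /fg_rev map_rev revK -map_comp map_id_in // => a _.
exact: fg_linvK.
Qed.

Record free_group := FreeGroup {
  fg_word : seq letter;
  fg_wordP : fg_reduced fg_word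
}.

HB.instance Definition _ := [isSub for fg_word].
HB.instance Definition _ := [Choice of free_group by <:].

Implicit Types x y z : free_group.

Definition fg_one : free_group := @FreeGroup [::] isT.
Definition fg_mul x y : free_group :=
  FreeGroup (fg_reduced_cat (fg_word x) (fg_wordP y)).
Definition fg_inv x : free_group := FreeGroup (fg_reduced_rev (fg_wordP x)).

Lemma fg_mulA : associative fg_mul.
Proof. by move=> x y z; apply/val_inj/fg_catA/fg_wordP. Qed.

Lemma fg_mul1 : left_id fg_one fg_mul.
Proof. by move=> x; apply/val_inj. Qed.

Lemma fg_mulg1 : right_id fg_one fg_mul.
Proof. by move=> x; apply/val_inj/fg_catw0/fg_wordP. Qed.

Lemma fg_mulV : left_inverse fg_one fg_inv fg_mul.
Proof. by move=> x; apply/val_inj/fg_catVw. Qed.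

Lemma fg_mulgV : right_inverse fg_one fg_inv fg_mul.
Proof.
move=> x; apply/val_inj; rewrite /= -[X in fg_cat X]fg_revK.
exact: fg_catVw.
Qed.

HB.instance Definition _ :=
  isGroup.Build free_group fg_mulA fg_mul1 fg_mulg1 fg_mulV fg_mulgV.

End FreeGroup.

Definition F2 : groupType := free_group 'I_2.

Section Groups.
Variable G : groupType.

Definition expgz (g : G) (n : int) : G :=
  match n with
  | Posz k => (g ^+ k)%g
  | Negz k => (g ^- k.+1)%g
  end.

Definition subgroup_gen (A : set G) : set G :=
  smallest (fun H : set G => group_closed [in H]) A.

Definition isomorphic_to (F : groupType) (H : set G) : Prop :=
  exists f : F -> G,
    {morph f : x y / (x * y)%g >-> (x * y)%g} /\ set_bij setT H f.

Definition conj_to_power_in (H : set G) (a g : G) : Prop :=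
  exists2 h, H h & exists n : int, g = (expgz a n ^ h)%g.

End Groups.

Section MetricSpaces.
Variables (R : realType) (X : metricType R).

Definition diameter (A : set X) : \bar R :=
  ereal_sup [set (mdist x y)%:E | x in A & y in A].

(* This is +oo when A or B is empty, so a lower bound on it is only meaningful
   for nonempty sets. *)
Definition set_dist (A B : set X) : \bar R :=
  ereal_inf [set (mdist x y)%:E | x in A & y in B].

(* c restricted to [0, d(x, y)] is a geodesic from x to y; the values of c
   outside this interval are irrelevant. *)
Definition is_geodesic (x y : X) (c : R -> X) : Prop :=
  [/\ c 0 = x, c (mdist x y) = y &
      {in `[0, mdist x y] &, forall s t, mdist (c s) (c t) = `|s - t|}].

Definition geodesic_space : Prop :=
  forall x y : X, exists c, is_geodesic x y c.

Definition gromov_product (x y z : X) : R :=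
  (mdist y x + mdist z x - mdist y z) / 2.

(* Exchanging (y, c1) and (z, c2) gives the other one of the two inclusions. *)
Definition hyperbolic (delta : R) : Prop :=
  forall (x y z : X) (c1 c2 : R -> X),
    is_geodesic x y c1 -> is_geodesic x z c2 ->
    {in `[0, gromov_product x y z], forall s,
      exists2 t, t \in `[0, gromov_product x y z] &
        mdist (c1 s) (c2 t) <= 2 * delta}.

Definition quasiconvex_hull (A : set X) : set X :=
  [set p | exists x y c, [/\ A x, A y, is_geodesic x y c &
    exists2 t, t \in `[0, mdist x y] & p = c t]].

Definition qi_embedding_int (f : int -> X) : Prop :=
  exists L A : R, [/\ 1 <= L, 0 <= A &
    forall m n : int,
      L^-1 * `|m - n|%:~R - A <= mdist (f m) (f n) <= L * `|m - n|%:~R + A].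

End MetricSpaces.

Section Actions.
Variables (R : realType) (G : groupType) (X : metricType R).
Variable act : G -> X -> X.

Definition isometric_action : Prop :=
  [/\ forall x, act 1%g x = x,
      forall g h x, act (g * h)%g x = act g (act h x) &
      forall g x y, mdist (act g x) (act g y) = mdist x y].

Definition almost_fixed_points (C : R) (g : G) : set X :=
  [set x | exists2 n : int, n != 0 & mdist x (act (expgz g n) x) <= C].

Definition almost_fixed_set (C : R) (g : G) : set X :=
  quasiconvex_hull (almost_fixed_points C g).

Definition loxodromic (g : G) : Prop :=
  exists x : X, qi_embedding_int (fun n => act (expgz g n) x).

End Actions.

(* Main.v *)
Require Import Defs.
From mathcomp Require Import all_boot all_order all_algebra.
From mathcomp Require Import all_classical all_reals all_analysis.
From mathcomp Require Import lra zify.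

(** Why the theorem is true.

    Write A1, A2 for the sets of almost fixed points of phi1, phi2, choose
    base points a in A1 and b in A2, and let m be the midpoint of a geodesic
    from a to b; everything is measured at m.  Hyperbolicity enters through
    the four-point inequality, with additive error e = 8 * delta
    ([hyperbolic_four_point]).

    The geometric heart is [bounded_orbit_almost_fixes].  Let g be a nonzero
    power of phi1.  The orbit of a under g stays in A1, hence within C' of a.
    If the geodesics from a to b and from a to g b ran together for much longer
    than C', a point x of the first one, chosen somewhat further than 2 * C'
    from a, would be moved by g essentially along that geodesic, by some shift
    tau.  The distance to x would then change by about tau at each step along
    the orbit of a; as that orbit is bounded, tau is at most e in absolute
    value.  So x is moved by at most 4 * e <= C and belongs to A1,
    although it is further than C' from a.  This contradiction bounds the
    Gromov product of b and g b at a, for all nonzero powers g of phi1 and all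
    b ([almost_fixed_gromov_product]).

    It follows that nontrivial powers of phi1 and phi2 move m by roughly the
    distance from a to b, and that two paths from m, to h m and to h' m with h
    a power of phi1 and h' a power of phi2, separate at once since they leave m
    towards a and towards b.  An alternating product of such powers thus
    carries m along a broken geodesic with long sides and almost no
    backtracking, and its displacement is at least the number of factors
    ([ping_pong_gromov_product]).

    The rest is combinatorics of alternating products.  A nontrivial reduced
    word of the free group evaluates to a nonempty one, hence moves m, which
    gives freeness.  Every alternating product can be conjugated to one with at
    most one factor, which is a power of phi1 or phi2, or to a cyclically
    alternating one ([cyclic_reduction]); the n-th power of the latter is
    alternating with n times as many factors, so its displacement of m grows
    linearly in n and it is loxodromic. *)

Set Implicit Arguments.
Unset Strict Implicit.
Unset Printing Implicit Defensive.

Import Order.TTheory GRing.Theory Num.Theory.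
Local Open Scope classical_set_scope.
Local Open Scope ring_scope.

(** * The four-point inequality *)

Lemma unbounded_of_increment (R : realType) (f : nat -> R) (c M : R) :
  0 < c -> (forall k, f k + c <= f k.+1) -> exists k, M < f k.
Proof.
move=> c0 fS.
have fk k : f 0%N + c * k%:R <= f k.
  elim: k => [|k IHk]; first by rewrite mulr0 addr0.
  by rewrite -natr1; have := fS k; lra.
pose k := Num.bound `|(M - f 0%N) / c|; exists k.
have : (M - f 0%N) / c < k%:R.
  by apply: (le_lt_trans (ler_norm _)); exact/archi_boundP/normr_ge0.
by rewrite ltr_pdivrMr // => ?; have := fk k; lra.
Qed.

Section FourPoint.
Variables (R : realType) (X : metricType R).
Local Notation d := (@mdist R X).
Local Notation tri := (@metric_triangle R X).
Local Notation dsym := (@metric_sym R X).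

(** Expanded form of the inequality
    (x, z)_w >= min ((x, y)_w, (y, z)_w) - e / 2 between Gromov products: of
    the three sums of opposite sides, none exceeds both others by more than e.
    The distance form leaves only linear arithmetic to do. *)
Definition four_point (e : R) : Prop := forall x y z w : X,
  d x z + d y w <= d x y + d z w + e \/ d x z + d y w <= d x w + d y z + e.

Lemma geodesic_dist (x y : X) (c : R -> X) (s : R) :
  is_geodesic x y c -> 0 <= s <= d x y ->
  d x (c s) = s /\ d (c s) y = d x y - s.
Proof.
move=> [c0 c1 cd] s_in; have d0 := mdist_ge0 x y.
have in0 : (0 : R) \in `[0, d x y] by rewrite in_itv /= lexx.
have in1 : d x y \in `[0, d x y] by rewrite in_itv /= lexx andbT.
have ins : s \in `[0, d x y] by rewrite in_itv.
rewrite -{1}c0 -[in d (c s) y]c1 !cd //; case/andP: s_in => s0 s1.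
by rewrite sub0r normrN ger0_norm // distrC ger0_norm // subr_ge0.
Qed.

Lemma gromov_product_ge0 (x y z : X) : 0 <= gromov_product x y z.
Proof.
by rewrite /gromov_product; have := tri y x z; rewrite (dsym x z); lra.
Qed.

Lemma gromov_product_le (x y z : X) : gromov_product x y z <= d x y.
Proof.
rewrite /gromov_product; have := tri z y x.
by rewrite (dsym y x) (dsym z y); lra.
Qed.

Lemma gromov_productC (x y z : X) :
  gromov_product x y z = gromov_product x z y.
Proof. by rewrite /gromov_product (dsym y z) addrC (addrC (d z x)) addrC. Qed.

(** A degenerate geodesic has to be in its own neighbourhood of radius
    2 * delta. *)
Lemma hyperbolic_ge0 (delta : R) (x : X) :
  geodesic_space X -> hyperbolic X delta -> 0 <= delta.
Proof.
move=> geo hyp; have [c cg] := geo x x.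
have gp0 : gromov_product x x x = 0 by rewrite /gromov_product !mdistxx; lra.
have [|t _] := hyp _ _ _ _ _ cg cg 0; first by rewrite gp0 in_itv /= lexx.
by have := mdist_ge0 (c 0) (c t); lra.
Qed.

(** With t the smaller of the products (x, y)_w and (y, z)_w, the point at
    distance t from w on the geodesic to y is close to both other geodesics;
    a path from x to z through that point is short. *)
Lemma hyperbolic_four_point (delta : R) :
  geodesic_space X -> hyperbolic X delta -> four_point (8 * delta).
Proof.
move=> geo hyp x y z w.
have [cx gx] := geo w x; have [cy gy] := geo w y; have [cz gz] := geo w z.
pose t := Num.min (gromov_product w y x) (gromov_product w y z).
have t0 : 0 <= t by rewrite le_min !gromov_product_ge0.
have t_le_x : t <= gromov_product w y x by rewrite ge_min lexx.
have t_le_z : t <= gromov_product w y z by rewrite ge_min lexx orbT.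
have near u c : is_geodesic w u c -> t <= gromov_product w y u ->
    d (cy t) u <= d w u - t + 4 * delta.
  move=> gu tu; have [|t' + dt'] := hyp _ _ _ _ _ gy gu t.
    by rewrite in_itv /= t0.
  rewrite in_itv /= => /andP[t'0 t'u].
  have [] := geodesic_dist (s := t') gu.
    by rewrite t'0 (le_trans t'u) // gromov_productC gromov_product_le.
  have [] := geodesic_dist (s := t) gy.
    by rewrite t0 (le_trans tu) // gromov_product_le.
  move=> wy _ wu cu.
  (* t' may differ from t by 2 * delta, which doubles the error *)
  have := tri (cy t) (c t') u; have := tri w (c t') (cy t).
  by rewrite (dsym (c t') (cy t)); lra.
have dxz := tri x (cy t) z.
have := near _ _ gx t_le_x; have := near _ _ gz t_le_z.
rewrite (dsym (cy t) x) /=.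
have : t = gromov_product w y x \/ t = gromov_product w y z.
  by rewrite /t; case: leP; [left|right].
rewrite /gromov_product !(dsym _ w) (dsym y x).
by case=> t_eq ? ?; [left|right]; lra.
Qed.

End FourPoint.

(** * Isometries with a bounded orbit *)

Section Action.
Variables (R : realType) (G : groupType) (X : metricType R).
Variable act : G -> X -> X.
Hypothesis iso : isometric_action act.
Local Notation d := (@mdist R X).
Local Notation tri := (@metric_triangle R X).
Local Notation dsym := (@metric_sym R X).

Lemma act1 x : act 1%g x = x. Proof. by case: iso. Qed.
Lemma actM g h x : act (g * h)%g x = act g (act h x). Proof. by case: iso. Qed.
Lemma dist_act g x y : d (act g x) (act g y) = d x y. Proof. by case: iso. Qed.

Lemma dist_actV g x y : d x (act g y) = d (act g^-1%g x) y.
Proof. by rewrite -(dist_act g (act _ x)) -actM mulgV act1. Qed.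

(** Since the geodesics from a to b and to g b stay together beyond x, the
    isometry g shifts x along them by an amount tau = d a x - d a (g x), up to
    2 * e.  From a point p of the orbit of a, which is much closer to a than x
    is, the same shift is seen up to e; so the distances from x to the orbit
    points g ^- k a form a sequence with increments close to - tau.  That
    sequence is bounded, whence |tau| <= e.  The last premise says that the
    Gromov product of b and g b at a is at least d a x + r. *)
Lemma bounded_orbit_almost_fixes (e r : R) (g : G) (a b x : X) :
  four_point X e -> 0 <= e ->
  (forall k, d a (act (g ^- k)%g a) <= r) ->
  d x b = d a b - d a x -> 2 * r + 2 * e < d a x ->
  2 * (d a x + r) <= d a b + d a (act g b) - d b (act g b) ->
  d x (act g x) <= 4 * e.
Proof.
move=> fp e0 orb xb ax; set y := act g x; set b' := act g b => bb'.
have r0 : 0 <= r by have := orb 0%N; rewrite invg1 act1 mdistxx.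
pose a' := act g a; have aa' : d a a' <= r.
  by have := orb 1%N; rewrite expg1 dist_actV invgK dsym.
have a'y : d a' y = d a x by rewrite dist_act.
have yb' : d y b' = d x b by rewrite dist_act.
have a'b' : d a' b' = d a b by rewrite dist_act.
have ay_lo : d a x - r <= d a y.
  by have := tri a' a y; rewrite (dsym a' a); lra.
have ay_hi : d a y <= d a x + r by have := tri a a' y; lra.
(* y = g x is almost on a geodesic from a to b' = g b, not only from g a *)
have ab' : d a y + d y b' - e <= d a b'.
  by have := fp a a' y b'; lra.
have xy : d x y <= d a x - d a y + 2 * e \/ d x y <= d a y - d a x + 2 * e.
  have := fp x b b' a; have := fp x b' y a.
  rewrite !(dsym _ a) (dsym b' y) (dsym x b').
  rewrite (dsym b' x).
  by lra.
pose tau := d a x - d a y.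
have shift k : let p := act (g ^- k)%g a in
    d p x - d p y <= tau + e /\ tau - e <= d p x - d p y.
  set p := act _ a; have ap : d a p <= r := orb k.
  have px := tri a p x; have py := tri a p y.
  have := fp a p x y; have := fp p a x y; have := dsym p a.
  by rewrite /tau /=; lra.
pose f k := d (act (g ^- k)%g a) x.
have fS k : f k.+1 = d (act (g ^- k)%g a) y.
  by rewrite /f /y dist_actV -actM expgSr invgM.
have f_ge0 k : 0 <= f k by exact: mdist_ge0.
have f_le k : f k <= d a x + r.
  have := tri (act (g ^- k)%g a) a x; have := orb k.
  by rewrite /f (dsym (act _ a) a); lra.
have : tau <= e.
  rewrite leNgt; apply/negP => tau_e.
  have [|k|k] := @unbounded_of_increment _ (fun k => - f k) (tau - e) 0.
  - by lra.
  - by have [_] := shift k; rewrite -fS -/(f k); lra.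
  - by have := f_ge0 k; lra.
have : - e <= tau.
  rewrite leNgt; apply/negP => tau_e.
  have [|k|k] := @unbounded_of_increment _ f (- tau - e) (d a x + r).
  - by lra.
  - by have [+ _] := shift k; rewrite -fS -/(f k); lra.
  - by have := f_le k; lra.
by rewrite /tau; lra.
Qed.

End Action.

(** * Integral powers *)

Lemma group_closed_set (G : groupType) (H : set G) :
  group_closed [in H] <->
  H 1%g /\ forall x y, H x -> H y -> H (x / y)%g.
Proof.
split=> [[H1 HB]|[H1 HB]].
  split=> [|x y Hx Hy]; first by move: H1; rewrite !inE.
  by have := HB x y; rewrite !inE; exact.
by split=> [|x y]; rewrite !inE //; exact: HB.
Qed.

Lemma group_closed_setV (G : groupType) (H : set G) (x : G) :
  group_closed [in H] -> H x -> H x^-1%g.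
Proof.
by case/group_closed_set=> H1 HB Hx; rewrite -[x^-1%g]div1g; exact: HB.
Qed.

Lemma group_closed_setM (G : groupType) (H : set G) (x y : G) :
  group_closed [in H] -> H x -> H y -> H (x * y)%g.
Proof.
move=> Hc Hx Hy; rewrite -[y]invgK; have [_] := (group_closed_set H).1 Hc.
by apply=> //; exact: group_closed_setV.
Qed.

Section Powers.
Variable G : groupType.
Implicit Types (g h : G) (n : int).

Lemma commute_expgz g h n : commute h g -> commute h (expgz g n).
Proof.
by move=> hg; case: n => k /=; [|apply: commuteV]; exact: commuteX.
Qed.

Lemma expgzS g n : expgz g (n + 1) = (g * expgz g n)%g.
Proof.
case: n => k; first by rewrite /= addn1 expgS.
have -> : Negz k + 1 = - k%:Z by rewrite NegzE -addn1 PoszD; lia.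
case: k => [|k]; first by rewrite /= expg1 mulgV.
by rewrite -NegzE /= [in RHS]expgSr invgM mulVKg.
Qed.

Lemma expgzD g m n : expgz g (m + n) = (expgz g m * expgz g n)%g.
Proof.
elim: m => [|k IHk|k IHk]; first by rewrite add0r mul1g.
  by rewrite -addn1 PoszD -addrA (addrC 1) addrA !expgzS IHk mulgA.
apply: (@mulgI _ g); rewrite mulgA -!expgzS.
by rewrite addrAC (_ : - k.+1%:Z + 1 = - k%:Z) //; lia.
Qed.

Lemma expgzB g m n : expgz g (m - n) = (expgz g m / expgz g n)%g.
Proof. by apply: (@mulIg _ (expgz g n)); rewrite -expgzD subrK mulgVK. Qed.

Definition powers g : set G := range (expgz g).

Lemma powers_closed g : group_closed [in powers g].
Proof.
apply/group_closed_set; split=> [|_ _ [m _ <-] [n _ <-]]; first by exists 0.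
by exists (m - n) => //; rewrite expgzB.
Qed.

End Powers.

(** * Alternating products and their cyclic reduction *)

Section NormalForms.
Variables (T : eqType) (G : groupType) (H : T -> set G).
Hypothesis H_closed : forall t, group_closed [in H t].
Local Notation syllable := (T * G)%type.
Implicit Types (p q : syllable) (s : seq syllable).

(** A syllable (t, h) is meant as a nontrivial element h of the subgroup H t;
    in an alternating sequence consecutive subgroups have different indices. *)
Definition syl_neq : rel syllable := fun p q => p.1 != q.1.

Definition is_syllable p : bool := (p.2 \in H p.1) && (p.2 != 1%g).

Definition normal_form s : bool := sorted syl_neq s && all is_syllable s.

Definition syl_prod s : G := (\prod_(p <- s) p.2)%g.

Lemma normal_form_cons p s : normal_form (p :: s) =
  [&& is_syllable p, path syl_neq p s & normal_form s].
Proof.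
rewrite /normal_form /=; case: (is_syllable p) => /=; last by rewrite andbF.
by case: (boolP (path _ _ _)) => //= /path_sorted ->.
Qed.

(** If the first and the last syllable belong to the same subgroup,
    conjugating by the last one moves it to the front, where it merges with the
    first one or cancels it; this shortens the sequence. *)
Lemma cyclic_reduction (K : set G) (s : seq syllable) :
  (forall t, H t `<=` K) -> group_closed [in K] -> normal_form s ->
  exists s' k, [/\ normal_form s', K k, syl_prod s = (syl_prod s' ^ k)%g &
    (size s' <= 1)%N || cycle syl_neq s'].
Proof.
move=> HK /[dup] K_closed /group_closed_set[K1 _].
have [n] := ubnP (size s); elim: n s => // n IHn [|p s] ltsn.
  by exists [::], 1%g; split=> //; rewrite conjg1.
case/lastP: s ltsn => [|s q] ltsn nf.
  by exists [:: p], 1%g; split=> //; rewrite conjg1.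
case: (eqVneq p.1 q.1) => [pq|pq]; last first.
  exists (p :: rcons s q), 1%g; split=> //; first by rewrite conjg1.
  rewrite /= rcons_path last_rcons {2}/syl_neq eq_sym pq andbT.
  by case/andP: nf => /= ->; rewrite orbT.
move: nf; rewrite normal_form_cons => /and3P[p_syl p_path].
rewrite /normal_form all_rcons => /and3P[s_sorted q_syl s_all].
have s_path : path syl_neq p s by move: p_path; rewrite rcons_path => /andP[].
have nf : normal_form s by rewrite /normal_form (path_sorted s_path).
have Kq : K q.2 by case/andP: q_syl; rewrite inE => /HK.
have prodE : syl_prod (p :: rcons s q) = ((q.2 * p.2 * syl_prod s) ^ q.2)%g.
  by rewrite /syl_prod big_cons big_rcons /= conjgE -!mulgA mulKg.
have conj_step s1 : (size s1 < n)%N -> normal_form s1 ->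
    (q.2 * p.2 * syl_prod s)%g = syl_prod s1 ->
  exists s' k, [/\ normal_form s', K k,
    syl_prod (p :: rcons s q) = (syl_prod s' ^ k)%g &
    (size s' <= 1)%N || cycle syl_neq s'].
  move=> lts1 nf1 eq1; have [s' [k [nf' Kk eq' cyc]]] := IHn s1 lts1 nf1.
  exists s', (k * q.2)%g; split=> //; last by rewrite prodE eq1 eq' conjgM.
  exact: group_closed_setM.
move: ltsn; rewrite /= size_rcons => ltsn.
have [qp1|qp1] := eqVneq (q.2 * p.2)%g 1%g.
  by apply: (conj_step s) => //; [exact: ltnW|rewrite qp1 mul1g].
apply: (conj_step ((p.1, (q.2 * p.2)%g) :: s)) => //=; last first.
  by rewrite /syl_prod big_cons.
rewrite normal_form_cons nf andbT /is_syllable /= qp1 andbT.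
apply/andP; split; last by case: s s_path {s_sorted s_all nf prodE conj_step
  ltsn p_path}.
case/andP: p_syl => /[!inE] Hp _; case/andP: q_syl => /[!inE] + _.
by rewrite -pq => Hq; exact: group_closed_setM.
Qed.

Lemma normal_form_expg s n : cycle syl_neq s -> normal_form s ->
  exists s', [/\ normal_form s', syl_prod s' = (syl_prod s ^+ n)%g &
    size s' = (n * size s)%N].
Proof.
move=> cyc /andP[sorted_s all_s]; exists (flatten (nseq n s)); split.
- apply/andP; split; last first.
    by elim: n => //= n IHn; rewrite all_cat all_s.
  case: s cyc sorted_s {all_s} => [|p s] /=; first by elim: n.
  rewrite rcons_path => /andP[p_s s_p] _.
  case: n => //= n; rewrite cat_path p_s /=.
  by elim: n => //= n IHn; rewrite s_p cat_path p_s.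
- rewrite /syl_prod; elim: n => [|n IHn] /=; first by rewrite big_nil.
  by rewrite big_cat /= IHn expgS.
- by elim: n => //= n IHn; rewrite size_cat IHn mulSn.
Qed.

End NormalForms.

(** * Evaluation of the free group *)

Section FreeGroupEval.
Variables (T : choiceType) (G : groupType) (phi : T -> G).
Implicit Types (a b : T * bool) (u w : seq (T * bool)).

Definition letter_eval a : G := if a.2 then phi a.1 else ((phi a.1)^-1)%g.

Definition word_eval w : G := (\prod_(a <- w) letter_eval a)%g.

Definition free_group_eval (x : free_group T) : G := word_eval (fg_word x).

Lemma letter_eval_linv a : letter_eval (fg_linv a) = ((letter_eval a)^-1)%g.
Proof. by case: a => t [] //=; rewrite /letter_eval /= invgK. Qed.

Lemma word_eval_cons a w : word_eval (a :: w) = (letter_eval a * word_eval w)%g.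
Proof. exact: big_cons. Qed.

Lemma word_eval_push a w :
  word_eval (fg_push a w) = (letter_eval a * word_eval w)%g.
Proof.
case: w => [|b w] /=; first exact: word_eval_cons.
case: eqP => [->|_]; last exact: word_eval_cons.
by rewrite word_eval_cons letter_eval_linv mulVKg.
Qed.

Lemma word_eval_cat u w :
  word_eval (fg_cat u w) = (word_eval u * word_eval w)%g.
Proof.
elim: u => [|a u IHu] /=; first by rewrite /word_eval big_nil mul1g.
by rewrite word_eval_push IHu word_eval_cons mulgA.
Qed.

Lemma free_group_evalM :
  {morph free_group_eval : x y / (x * y)%g >-> (x * y)%g}.
Proof. by move=> x y; exact: word_eval_cat. Qed.

Lemma free_group_eval1 : free_group_eval 1%g = 1%g.
Proof. exact: big_nil. Qed.

Lemma free_group_evalB x y :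
  free_group_eval (x / y)%g = (free_group_eval x / free_group_eval y)%g.
Proof.
by apply: (@mulIg _ (free_group_eval y)); rewrite -free_group_evalM !mulgVK.
Qed.

Lemma free_group_eval_range : range free_group_eval = subgroup_gen (range phi).
Proof.
apply/seteqP; split=> [_ [x _ <-]|].
  move=> K [K_closed phiK]; have Kphi t : K (phi t) by apply: phiK; exists t.
  have Kl a : K (letter_eval a).
    by rewrite /letter_eval; case: a.2 => //; exact: group_closed_setV.
  rewrite /free_group_eval; elim: (fg_word x) => [|a w IHw].
    by rewrite /word_eval big_nil; case/group_closed_set: K_closed.
  by rewrite word_eval_cons; exact: group_closed_setM.
apply: smallest_sub.
  apply/group_closed_set; split.
    by exists 1%g => //; exact: free_group_eval1.
  move=> _ _ [x _ <-] [y _ <-].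
  by exists (x / y)%g => //; exact: free_group_evalB.
move=> _ [t _ <-]; exists (@FreeGroup _ [:: (t, true)] isT) => //.
by rewrite /free_group_eval /word_eval big_seq1.
Qed.

Lemma letter_eval_power a n : powers (phi a.1) (letter_eval a ^+ n)%g.
Proof.
rewrite /letter_eval; case: a.2; first by exists n%:Z.
by case: n => [|n]; [exists 0|exists (Negz n); rewrite //= expVgn].
Qed.

Hypothesis phi_free : forall t n, (phi t ^+ n.+1)%g != 1%g.

Lemma letter_eval_free a n : (letter_eval a ^+ n.+1)%g != 1%g.
Proof.
rewrite /letter_eval; case: a.2; first exact: phi_free.
by rewrite expVgn invg_eq1 phi_free.
Qed.

(** Maximal runs of a letter become syllables.  The run at the head of the word
    is kept apart, as a positive power of its first letter, so that a further
    equal letter can be absorbed without cancellation. *)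
Lemma reduced_word_normal_form a w : fg_reduced (a :: w) ->
  exists n s, [/\ normal_form (fun t => powers (phi t)) s,
    path (@syl_neq T G) (a.1, 1%g) s &
    word_eval (a :: w) = (letter_eval a ^+ n.+1 * syl_prod s)%g].
Proof.
elim: w a => [|b w IHw] a.
  exists 0%N, [::]; split=> //.
  by rewrite /word_eval big_seq1 /syl_prod big_nil mulg1.
move=> /= /andP[ab /IHw[n [s [nf ps eqs]]]].
rewrite word_eval_cons eqs; case: (eqVneq a.1 b.1) => [ab1|ab1].
  (* same generator and no cancellation, hence the same letter *)
  have <- : a = b.
    case: a b ab ab1 {IHw ps eqs} => [t x] [u y] /= + tu.
    by rewrite /fg_linv xpair_eqE tu eqxx /=; case: x y => [] [].
  by exists n.+1, s; rewrite ab1 mulgA -expgS.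
exists 0%N, ((b.1, (letter_eval b ^+ n.+1)%g) :: s); split.
- rewrite normal_form_cons nf andbT /is_syllable /= letter_eval_free andbT.
  apply/andP; split; last by case: s ps {nf eqs}.
  by rewrite inE; exact: letter_eval_power.
- by rewrite /= /syl_neq ab1 /=; case: s ps {nf eqs}.
- by rewrite expg1 /syl_prod big_cons.
Qed.

Lemma free_group_eval_normal_form (x : free_group T) : exists s,
  [/\ normal_form (fun t => powers (phi t)) s, free_group_eval x = syl_prod s &
      s = [::] -> x = 1%g].
Proof.
case: x => [[|a w] w_red].
  exists [::]; split=> //; last by move=> _; exact/val_inj.
  by rewrite /syl_prod /free_group_eval /word_eval !big_nil.
have [n [s [nf ps eqs]]] := reduced_word_normal_form w_red.
exists ((a.1, (letter_eval a ^+ n.+1)%g) :: s); split=> //; last first.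
  by rewrite /free_group_eval eqs /syl_prod big_cons.
rewrite normal_form_cons nf andbT /is_syllable /= letter_eval_free andbT.
apply/andP; split; last by case: s ps {nf eqs}.
by rewrite inE; exact: letter_eval_power.
Qed.

End FreeGroupEval.

Lemma conj_expgz (G : groupType) (g h : G) (n : int) :
  expgz (g ^ h)%g n = (expgz g n ^ h)%g.
Proof. by case: n => k /=; rewrite -conjXg ?conjVg. Qed.

Lemma powers_subset (G : groupType) (K : set G) (g : G) :
  group_closed [in K] -> K g -> powers g `<=` K.
Proof.
move=> Kc Kg _ [n _ <-]; have Kn k : K (g ^+ k)%g.
  elim: k => [|k IHk]; first by case/group_closed_set: Kc.
  by rewrite expgS; exact: group_closed_setM.
by case: n => k //=; exact: group_closed_setV.
Qed.

(** * Displacement and loxodromic elements *)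

Section Dynamics.
Variables (R : realType) (G : groupType) (X : metricType R).
Variable act : G -> X -> X.
Hypothesis iso : isometric_action act.
Local Notation d := (@mdist R X).
Local Notation tri := (@metric_triangle R X).
Local Notation dsym := (@metric_sym R X).

Lemma dist_act_expgn (g : G) (x : X) (n : nat) :
  d x (act (g ^+ n)%g x) <= n%:R * d x (act g x).
Proof.
elim: n => [|n IHn]; first by rewrite (act1 iso) mdistxx mul0r.
have := tri x (act g x) (act (g ^+ n.+1)%g x).
by rewrite expgS (actM iso) (dist_act iso) -natr1 mulrDl mul1r; lra.
Qed.

Lemma loxodromic_conj (g h : G) : loxodromic act g -> loxodromic act (g ^ h)%g.
Proof.
case=> x [L [A [L1 A0 qi]]]; exists (act h^-1%g x), L, A; split=> // m n.
have gh k : act (expgz (g ^ h)%g k) (act h^-1%g x) =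
    act h^-1%g (act (expgz g k) x).
  by rewrite conj_expgz -!(actM iso) conjgE -!mulgA mulgV mulg1.
by rewrite !gh (dist_act iso).
Qed.

Lemma loxodromic_of_displacement (g : G) (x : X) :
  (forall n : nat, n%:R <= d x (act (g ^+ n)%g x)) -> loxodromic act g.
Proof.
move=> disp; exists x, (1 + d x (act g x)), 0.
have dx0 := mdist_ge0 x (act g x).
split=> [||m n]; [by lra|by []|rewrite subr0 addr0].
have -> : d (act (expgz g m) x) (act (expgz g n) x) =
    d x (act (g ^+ `|m - n|)%g x).
  have -> : d (act (expgz g m) x) (act (expgz g n) x) =
      d (act (expgz g (m - n)) x) x.
    have -> : expgz g m = (expgz g n * expgz g (m - n))%g.
      by rewrite -expgzD addrC subrK.
    by rewrite (actM iso) (dist_act iso).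
  case: (m - n) => k /=; first by rewrite dsym.
  by rewrite -(dist_actV iso).
have -> : `|m - n|%:~R = `|m - n|%N%:R :> R by rewrite -abszE pmulrn.
set k := `|m - n|%N; have k0 : 0 <= k%:R :> R by exact: ler0n.
apply/andP; split.
  apply: le_trans (disp k); rewrite ler_pdivrMl; last by lra.
  by rewrite ler_peMl //; lra.
by apply: (le_trans (dist_act_expgn g x k)); rewrite mulrC ler_wpM2r //; lra.
Qed.

(** * Almost fixed points *)

Section AlmostFixed.
Variables (C e r : R) (g : G) (a : X).
Local Notation A := (almost_fixed_points act C g).
Hypotheses (geo : geodesic_space X) (fp : four_point X e) (e0 : 0 <= e).
Hypotheses (eC : 4 * e <= C) (A_diam : forall x y, A x -> A y -> d x y <= r).
Hypothesis Aa : A a.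

(** In particular the set of almost fixed points is invariant under the powers
    of g. *)
Lemma almost_fixed_points_act (h : G) (x : X) :
  commute h g -> A x -> A (act h x).
Proof.
move=> hg [n n0 dx]; exists n => //.
by rewrite -(actM iso) -(commute_expgz n hg) (actM iso) (dist_act iso).
Qed.

(** Otherwise the point at distance s = 2 * r + 2 * e + 1 from a on a geodesic
    to b would be almost fixed, too far from a; s is just above the threshold
    of [bounded_orbit_almost_fixes], and the bound is 2 * (s + r). *)
Lemma almost_fixed_gromov_product (b : X) (n : int) : n != 0 ->
  d a b + d a (act (expgz g n) b) - d b (act (expgz g n) b)
    <= 2 * (3 * r + 2 * e + 1).
Proof.
move=> n0; set h := expgz g n; rewrite leNgt; apply/negP => big.
have e_ge0 := e0.
have r0 : 0 <= r by have := A_diam Aa Aa; rewrite mdistxx.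
have [c gc] := geo a b; pose s := 2 * r + 2 * e + 1.
have ab : d a (act h b) <= d a b + d b (act h b) by exact: tri.
have [|as_ sb] := @geodesic_dist R X a b c s gc.
  by rewrite /s; apply/andP; split; lra.
have orb k : d a (act (h ^- k)%g a) <= r.
  apply: A_diam => //; apply: almost_fixed_points_act => //.
  apply/commute_sym/commuteV/commuteX; exact: commute_expgz.
suff : d a (c s) <= r by rewrite as_ /s; lra.
apply: A_diam => //; exists n => //; apply: le_trans eC.
apply: (bounded_orbit_almost_fixes iso (a := a) (b := b) (r := r)) => //.
- by rewrite as_.
- by rewrite as_ /s; lra.
- by rewrite as_ /s -/h; lra.
Qed.

Lemma almost_fixed_displacement (m : X) (h : G) : powers g h -> h != 1%g ->
  d a (act h m) <= d a m + r /\
  2 * d a m - r - 2 * (3 * r + 2 * e + 1) <= d m (act h m).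
Proof.
case=> n _ <- hn; have n0 : n != 0 by apply: contraNneq hn => ->.
set f := expgz g n; have af : d a (act f a) <= r.
  by apply: A_diam => //; apply: almost_fixed_points_act => //;
    apply/commute_sym/commute_expgz.
have := almost_fixed_gromov_product m n0; rewrite -/f.
have := tri a (act f a) (act f m); have := tri (act f a) a (act f m).
by rewrite (dist_act iso) (dsym (act f a) a) /=; lra.
Qed.

End AlmostFixed.

(** * Ping-pong *)

(** Seen from the midpoint m of a and b, the points p and q lie in the
    directions of a and b respectively, and these two are opposite: the
    Gromov product of a and b at m is 0. *)
Lemma transverse_gromov_product (e r E rho : R) (m a b p q : X) :
  four_point X e -> 0 <= e -> r + 2 * e < E ->
  d a m = rho -> d b m = rho -> d a b = 2 * rho ->
  d a p <= rho + r -> d b q <= rho + r -> E <= d m p -> E <= d m q ->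
  d m p + d m q - d p q <= 2 * e.
Proof.
move=> fp e_ge0 Ere am bm ab ap bq mp mq.
have := fp a p q m; have := fp a q b m.
by rewrite (dsym p m) (dsym q m) (dsym q b) /=; lra.
Qed.

Section PingPong.
Variables (T : eqType) (H : T -> set G) (e E : R) (m : X).
Hypothesis H_closed : forall t, group_closed [in H t].
Hypotheses (fp : four_point X e) (e0 : 0 <= e) (E_large : 3 * e + 1 <= E).
Hypothesis disp : forall t h, H t h -> h != 1%g -> E <= d m (act h m).
Hypothesis cross : forall t t' h h', t != t' -> H t h -> h != 1%g ->
  H t' h' -> h' != 1%g ->
  d m (act h m) + d m (act h' m) - d (act h m) (act h' m) <= 2 * e.

(** Local-to-global principle for the broken geodesic through the images of m
    under the prefixes of an alternating product.  The two parts feed each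
    other: as the product of h m and (k w) m at m is small, prepending h adds
    d m (h m) to the displacement up to 3 * e; and as k w displaces m much
    further than its tail w, (k w) m lies in the direction of k m, so the
    product of h m and (k w) m is that of h m and k m up to e. *)
Lemma ping_pong_gromov_product (s : seq (T * G)) : normal_form H s ->
  (size s)%:R <= d m (act (syl_prod s) m) /\
  forall t h, H t h -> h != 1%g -> s != [::] -> path (@syl_neq T G) (t, h) s ->
  d m (act h m) + d m (act (syl_prod s) m) -
    d (act h m) (act (syl_prod s) m) <= 3 * e.
Proof.
have [e_ge0 E_ge] := (e0, E_large).
elim: s => [|[u k] s IHs]; first by split=> //; exact: mdist_ge0.
rewrite normal_form_cons => /and3P[/andP[/= /[!inE] Hk k1] us nf].
have [size_s gp_s] := IHs nf.
have -> : syl_prod ((u, k) :: s) = (k * syl_prod s)%g by exact: big_cons.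
set w := syl_prod s in size_s gp_s *.
have dkw : d (act k m) (act (k * w)%g m) = d m (act w m).
  by rewrite (actM iso) (dist_act iso).
have dmk := disp Hk k1.
have step : d m (act k m) + d m (act w m) - 3 * e <= d m (act (k * w)%g m).
  case: (eqVneq s [::]) => [s0|s0].
    by rewrite /w s0 /syl_prod big_nil mulg1 (act1 iso) mdistxx; lra.
  have := gp_s u k^-1%g (group_closed_setV (H_closed u) Hk).
  have -> : d m (act k^-1%g m) = d m (act k m).
    by rewrite (dist_actV iso) invgK dsym.
  rewrite invg_eq1 -(dist_actV iso) -(actM iso) => /(_ k1 s0) gp.
  have : path (@syl_neq T G) (u, k^-1%g) s by case: (s) us.
  by move/gp; lra.
split=> [|t h Ht h1 _ /andP[tu _]]; first by rewrite /= -natr1; lra.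
have := cross tu Ht h1 Hk k1.
have := fp (act h m) (act (k * w)%g m) (act k m) m.
have := mdist_ge0 m (act w m).
rewrite (dsym (act (k * w)%g m) m) (dsym (act h m) m) (dsym (act k m) m).
by rewrite (dsym (act (k * w)%g m) (act k m)) dkw; lra.
Qed.

Lemma ping_pong_dist (s : seq (T * G)) :
  normal_form H s -> (size s)%:R <= d m (act (syl_prod s) m).
Proof. by case/ping_pong_gromov_product. Qed.

Lemma ping_pong_trivial (s : seq (T * G)) :
  normal_form H s -> syl_prod s = 1%g -> s = [::].
Proof.
move=> /ping_pong_dist + s1; rewrite s1 (act1 iso) mdistxx.
by rewrite lern0 size_eq0 => /eqP.
Qed.

Lemma ping_pong_loxodromic (s : seq (T * G)) : normal_form H s ->
  s != [::] -> cycle (@syl_neq T G) s -> loxodromic act (syl_prod s).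
Proof.
move=> nf s0 cyc; apply: (@loxodromic_of_displacement _ m) => n.
have [s' [nf' <- size_s']] := normal_form_expg n cyc nf.
apply: le_trans (ping_pong_dist nf'); rewrite ler_nat size_s'.
by rewrite leq_pmulr // lt0n size_eq0.
Qed.

End PingPong.

End Dynamics.

Lemma almost_fixed_points_sub (R : realType) (G : groupType) (X : metricType R)
    (act : G -> X -> X) (C : R) (g : G) :
  geodesic_space X -> almost_fixed_points act C g `<=` almost_fixed_set act C g.
Proof.
move=> geo x Ax; have [c gc] := geo x x; exists x, x, c; split=> //.
by exists 0; [rewrite in_itv /= lexx mdistxx lexx|case: gc].
Qed.

Theorem theorem1p3 (R : realType) (delta C C' : R) (hC : 100 * delta < C) :
  exists C1 : R,
  forall (G : groupType) (X : metricType R) (act : G -> X -> X)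
    (phi1 phi2 : G),
  geodesic_space X -> hyperbolic X delta -> isometric_action act ->
  almost_fixed_set act C phi1 !=set0 ->
  almost_fixed_set act C phi2 !=set0 ->
  (diameter (almost_fixed_set act C phi1) <= C'%:E)%E ->
  (diameter (almost_fixed_set act C phi2) <= C'%:E)%E ->
  (C1%:E <= set_dist (almost_fixed_set act C phi1)
                     (almost_fixed_set act C phi2))%E ->
  isomorphic_to F2 (subgroup_gen [set phi1; phi2]) /\
  (forall g : G, subgroup_gen [set phi1; phi2] g ->
    ~ conj_to_power_in (subgroup_gen [set phi1; phi2]) phi1 g ->
    ~ conj_to_power_in (subgroup_gen [set phi1; phi2]) phi2 g ->
    loxodromic act g).
Proof.
(* so that E below is at least C' + 3 * e + 1, as both uses of it require *)
exists (8 * C' + 7 * (8 * delta) + 3) => G X act phi1 phi2 geo hyp iso.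
move=> [_ [a [_ [_ [Aa _ _ _]]]]] [_ [b [_ [_ [Bb _ _ _]]]]].
move=> diam1 diam2 dist12.
set e := 8 * delta in dist12.
have delta0 := hyperbolic_ge0 a geo hyp.
have fp : four_point X e := hyperbolic_four_point geo hyp.
have e0 : 0 <= e by rewrite /e; lra.
have eC : 4 * e <= C by rewrite /e; lra.
pose phi (i : 'I_2) := if i == ord0 then phi1 else phi2.
pose c (i : 'I_2) := if i == ord0 then a else b.
have range_phi : [set phi1; phi2] = range phi.
  apply/seteqP; split=> [_ [->|->]|_ [i _ <-]].
  - by exists ord0.
  - by exists ord_max.
  - by rewrite /phi; case: ifP => _; [left|right].
have diam_le g x y : (diameter (almost_fixed_set act C g) <= C'%:E)%E ->
    almost_fixed_points act C g x -> almost_fixed_points act C g y ->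
    mdist x y <= C'.
  move=> diamg Ax Ay; rewrite -lee_fin; apply: le_trans diamg.
  by apply: ereal_sup_ubound; exists x; [|exists y => //];
    exact: almost_fixed_points_sub.
have diam i x y : almost_fixed_points act C (phi i) x ->
    almost_fixed_points act C (phi i) y -> mdist x y <= C'.
  by rewrite /phi; case: ifP => _; exact: diam_le.
have Ac i : almost_fixed_points act C (phi i) (c i).
  by rewrite /phi /c; case: ifP.
have ab : 8 * C' + 7 * e + 3 <= mdist a b.
  rewrite -lee_fin; apply: (le_trans dist12); apply: ereal_inf_lbound.
  by exists a; [|exists b => //]; exact: almost_fixed_points_sub.
have r0 : 0 <= C' by have := diam _ _ _ (Ac ord0) (Ac ord0); rewrite mdistxx.
pose rho := mdist a b / 2; have [gam ggam] := geo a b.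
pose m := gam rho; have [|am mb] := @geodesic_dist R X a b gam rho ggam.
  by rewrite /rho; apply/andP; split; lra.
have cm i : mdist (c i) m = rho.
  rewrite /c; case: ifP => _ //; rewrite metric_sym mb /rho; lra.
have cc i j : i != j -> mdist (c i) (c j) = 2 * rho.
  rewrite /c /rho; case: i j => [[|[|//]] ?] [[|[|//]] ?] //= _.
    by lra.
  by rewrite metric_sym; lra.
pose H i := powers (phi i).
have H_closed i : group_closed [in H i] by exact: powers_closed.
(* lower bound on the displacement of m by nontrivial powers *)
pose E := 2 * rho - C' - 2 * (3 * C' + 2 * e + 1).
have E_large : 3 * e + 1 <= E by rewrite /E /rho; lra.
have Ere : C' + 2 * e < E by rewrite /E /rho; lra.
have disp i h : H i h -> h != 1%g ->
    mdist (c i) (act h m) <= rho + C' /\ E <= mdist m (act h m).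
  move=> Hh h1; rewrite /E -{1 2}(cm i).
  exact: (almost_fixed_displacement iso geo fp e0 eC (@diam i) (Ac i) m Hh h1).
have cross i j h h' : i != j -> H i h -> h != 1%g -> H j h' -> h' != 1%g ->
    mdist m (act h m) + mdist m (act h' m) - mdist (act h m) (act h' m)
      <= 2 * e.
  move=> ij Hh h1 Hh' h1'; have [? ?] := disp i h Hh h1.
  have [? ?] := disp j h' Hh' h1'.
  exact: (transverse_gromov_product fp e0 Ere (cm i) (cm j) (cc i j ij)).
have disp2 i h Hh h1 := (disp i h Hh h1).2.
have phi_free i n : (phi i ^+ n.+1)%g != 1%g.
  have := almost_fixed_gromov_product iso geo fp e0 eC (@diam i) (Ac i) m.
  move=> /(_ n.+1 isT) /= gp; apply/eqP => phi1'; move: gp.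
  by rewrite phi1' (act1 iso) mdistxx cm; move: E_large; rewrite /E; lra.
rewrite range_phi -(free_group_eval_range phi); split.
  exists (free_group_eval phi); split; first exact: free_group_evalM.
  split=> [x _|x y _ _ fxy|//]; first by exists x.
  have [s [nf eqs triv]] := free_group_eval_normal_form phi_free (x / y)%g.
  apply: divg1_eq; apply: triv.
  apply: (ping_pong_trivial iso H_closed fp e0 E_large disp2 cross nf).
  by rewrite -eqs free_group_evalB fxy mulgV.
move=> g [x _ <-]; have [s [nf -> _]] := free_group_eval_normal_form phi_free x.
rewrite (free_group_eval_range phi); set K := subgroup_gen _.
have K_closed : group_closed [in K].
  apply/group_closed_set; split=> [B [/group_closed_set[]] //|].
  move=> u v Ku Kv B [Bc phiB]; have [_] := (group_closed_set B).1 Bc.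
  by apply; [apply: Ku|apply: Kv].
have HK i : H i `<=` K.
  by apply: powers_subset => // B [_]; apply; exists i.
have [s' [k [nf' Kk -> cyc]]] := cyclic_reduction H_closed HK K_closed nf.
move=> not1 not2; apply: loxodromic_conj => //.
case: s' nf' cyc not1 not2 => [|p s'] nf' cyc not1 not2.
  case: not1; exists k => //; exists 0.
  by rewrite /syl_prod big_nil.
apply: (ping_pong_loxodromic iso H_closed fp e0 E_large disp2 cross nf') => //.
case/orP: cyc => //; rewrite ltnS leqn0 size_eq0 => /eqP s'0.
exfalso; move: nf'; rewrite s'0 normal_form_cons.
case/and3P=> /andP[/set_mem[n _ pn] _] _ _.
move: not1 not2; rewrite /syl_prod s'0 big_seq1 -pn /phi.
by case: ifP => _ not1 not2; [case: not1|case: not2]; exists k => //; exists n.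
Qed.
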